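(* Let $\mathfrak{P}$ be a well-formed PCFP with location labeling $L$ and goal predicate $\vartheta$, and let $l \in \mathsf{Loc}\setminus\{l_\iota\}$ be a location that has no self-loops and is not a potential goal with respect to $\vartheta$. Then the algorithm ''while there exists a transition $l' \xrightarrow{\varphi \to p : u} l$ in $\mathfrak{P}$, eliminate that transition'' terminates, and the resulting PCFP $\mathfrak{P}'$ is such that $l$ is unreachable and $\mathbb{P}_{\mathfrak{P}}(\lozenge G_\vartheta) = \mathbb{P}_{\mathfrak{P}'}(\lozenge G_\vartheta)$.
   Context: Variables, valuations, updates, guards: $\mathsf{Var}$ is a finite set of integer variables; an update $u = [x_1' = f_1, \dots, x_n' = f_n]$ executes integer-valued assignments simultaneously, mapping valuation $\nu$ to $u(\nu)$; $u_1;u_2$ is the chained update (first $u_1$, then $u_2$). A command has the form $l, \varphi \to p_1 : u_1 : l_1 + \dots + p_k : u_k : l_k$ (locations, guard $\varphi$ a Boolean expression over $\mathsf{Var}$, updates, constant probabilities $p_i\ge0$ summing to 1); each summand is a transition $l \xrightarrow{\varphi \to p_i : u_i} l_i$. A location $l$ has a self-loop if some transition $l \xrightarrow{\varphi\to p:u} l$ exists. A PCFP $\mathfrak{P} = (\mathsf{Loc}, \mathsf{Var}, \mathsf{dom}, \mathsf{Cmd}, \iota)$ has finite nonempty location set, finite domains $\mathsf{dom}(x)\subseteq\mathbb{Z}$, commands $\mathsf{Cmd}$, initial pair $\iota=(l_\iota,\nu_\iota)$. Semantic MDP $\mathcal{M}_{\mathfrak{P}}$: states $\mathsf{Loc}\times\{\nu\in\mathsf{dom}\}\cup\{\bot\}$,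 initial state $\langle l_\iota,\nu_\iota\rangle$, one action $a_\gamma$ per command $\gamma$; for transition $l\xrightarrow{\varphi\to p:u}l'$ of $\gamma$ and $\nu\in\mathsf{dom}$, $\nu\models\varphi$: $\langle l,\nu\rangle\xrightarrow{a_\gamma,p}\langle l',u(\nu)\rangle$ if $u(\nu)\in\mathsf{dom}$, else to $\bot$. Well-formed: $\bot$ unreachable from the initial state. Goals: $L:\mathsf{Loc}\to\mathbb{Z}^{\mathsf{Var}''}$ labels locations with valuations of extra variables $\mathsf{Var}''$ disjoint from $\mathsf{Var}$; $\vartheta$ is a predicate over $\mathsf{Var}\uplus\mathsf{Var}''$; $G_\vartheta=\{\langle l,\nu\rangle : (\nu,L(l))\models\vartheta\}$; $l$ is a potential goal if $\vartheta[L(l)]$ is satisfiable in $\mathsf{dom}$. $\mathbb{P}_{\mathfrak{P}}(\lozenge G_\vartheta)$ is the probability of reaching $G_\vartheta$ in $\mathcal{M}_{\mathfrak{P}}$ (the optimal — maximal, or respectively minimal — one over schedulers in the nondeterministic case). Weakest precondition: $\wp([x_1'=f_1,\dots,x_n'=f_n],\psi)=\psi[x_1/f_1]\dots[x_n/f_n]$ (syntactic substitution), $\wp(u_1;u_2,\psi)=\wp(u_1,\wp(u_2,\psi))$. Transition elimination of $\hat l \xrightarrow{\varphi\to p:u} l_1$, belonging to the command $\gamma:\ \hat l,\varphi\to p:u:l_1+\sum_{j=1}^n p_j:u_j:l_j$, where $\gamma_i:\ l_1,\psi_i\to\sum_{j=1}^{m_i}q_{ij}:v_{ij}:l_{ij}$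 ($i=1,\dots,m$) are all commands at $l_1$: remove $\gamma$ and add, for each $i$, the command $\hat l,\ \varphi\wedge\wp(u,\psi_i)\to\sum_{j=1}^n p_j:u_j:l_j+\sum_{j=1}^{m_i}p\,q_{ij}:(u;v_{ij}):l_{ij}$. (Locations need not be distinct; if $\gamma$ has several transitions into $l_1$, one of them is eliminated and the others remain in the new commands.)
   Formalization: Adds that every reachable state at l enables some command (else eliminating l0 → 1/2:goal + 1/2:l, with no command at l, drops the probability from 1/2 to 0); reachability, also in ''well-formed'', follows transitions of probability 0 as well. *)

(* Defs.v *)
(* Probabilistic control flow programs (PCFPs), their semantic MDPs, and the
   elimination of locations. *)
From mathcomp Require Import all_boot all_order all_algebra finmap.
From mathcomp Require Import all_classical all_reals all_analysis.
From Stdlib Require Import Relation_Operators.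

Set Implicit Arguments.
Unset Strict Implicit.
Unset Printing Implicit Defensive.

Import Order.TTheory GRing.Theory Num.Theory.

Local Open Scope ring_scope.

(* Expressions are syntactic, since weakest preconditions are defined by
   substitution.  The signature is left open: any function of k integers may
   label a k-ary node, and any predicate on k integers a k-ary atom. *)
Inductive aexp (V : Type) : Type :=
  | AVar (x : V)
  | AConst (z : int)
  | AOp (k : nat) (f : ('I_k -> int) -> int) (args : 'I_k -> aexp V).

Inductive bexp (V : Type) : Type :=
  | BAtom (k : nat) (r : ('I_k -> int) -> bool) (args : 'I_k -> aexp V)
  | BNot (b : bexp V)
  | BAnd (b1 b2 : bexp V).

Fixpoint aeval (V : Type) (nu : V -> int) (e : aexp V) : int :=
  match e with
  | AVar x => nu x
  | AConst z => z
  | AOp _ f args => f (fun i => aeval nu (args i))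
  end.

Fixpoint beval (V : Type) (nu : V -> int) (b : bexp V) : bool :=
  match b with
  | BAtom _ r args => r (fun i => aeval nu (args i))
  | BNot b1 => ~~ beval nu b1
  | BAnd b1 b2 => beval nu b1 && beval nu b2
  end.

Fixpoint asubst (V W : Type) (s : V -> aexp W) (e : aexp V) : aexp W :=
  match e with
  | AVar x => s x
  | AConst z => AConst W z
  | AOp _ f args => AOp f (fun i => asubst s (args i))
  end.

Fixpoint bsubst (V W : Type) (s : V -> aexp W) (b : bexp V) : bexp W :=
  match b with
  | BAtom _ r args => BAtom r (fun i => asubst s (args i))
  | BNot b1 => BNot (bsubst s b1)
  | BAnd b1 b2 => BAnd (bsubst s b1) (bsubst s b2)
  end.

(* [UAssign f] is the simultaneous assignment x' = f x for all x; a variable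
   that is not assigned has f x = AVar x.  [UChain u1 u2] is u1;u2. *)
Inductive update (V : Type) : Type :=
  | UAssign (f : V -> aexp V)
  | UChain (u1 u2 : update V).

Fixpoint upd (V : Type) (u : update V) (nu : V -> int) : V -> int :=
  match u with
  | UAssign f => fun x => aeval nu (f x)
  | UChain u1 u2 => upd u2 (upd u1 nu)
  end.

(* As assignments are simultaneous, so is the substitution. *)
Fixpoint wp (V : Type) (u : update V) (psi : bexp V) : bexp V :=
  match u with
  | UAssign f => bsubst f psi
  | UChain u1 u2 => wp u1 (wp u2 psi)
  end.

(* [mbranch s a] lists the labelled edges s --a,p--> t as pairs (p, t); it is
   meaningful only when [mavail s a].  Edges of probability 0 and parallel
   edges are allowed. *)
Record mdp (R : realType) : Type := MDP {
  mstate : finType;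
  mact : finType;
  minit : mstate;
  mavail : mstate -> mact -> bool;
  mbranch : mstate -> mact -> seq (R * mstate)
}.
Arguments minit {R} M : rename.
Arguments mavail {R} M s a : rename.
Arguments mbranch {R} M s a : rename.

Section MDPTheory.
Variables (R : realType) (M : mdp R).
Local Notation S := (mstate M).
Local Notation A := (mact M).

Definition mprob (s : S) (a : A) (t : S) : R :=
  \sum_(b <- mbranch M s a | b.2 == t) b.1.

(* Reachability along edges, whatever their probability. *)
Inductive reachable : S -> Prop :=
  | reach_init : reachable (minit M)
  | reach_step s a p t : reachable s -> mavail M s a ->
      (p, t) \in mbranch M s a -> reachable t.

(* The sequence [:: (a_1, s_1); ...; (a_n, s_n)] stands for the finite path
   minit a_1 s_1 ... a_n s_n. *)
Definition fpath := seq (A * S).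

Definition path_end (w : fpath) : S := last (minit M) (map snd w).

Definition scheduler := fpath -> A -> R.

(* Randomized and history-dependent; runs stop in states without available
   actions. *)
Definition is_scheduler (sigma : scheduler) : Prop :=
  forall w : fpath,
    [/\ forall a, 0 <= sigma w a,
        forall a, ~~ mavail M (path_end w) a -> sigma w a = 0
      & (exists a, mavail M (path_end w) a) -> \sum_a sigma w a = 1].

Fixpoint path_prob_from (sigma : scheduler) (h w : fpath) : R :=
  if w is e :: w' then
    sigma h e.1 * mprob (path_end h) e.1 e.2 *
      path_prob_from sigma (rcons h e) w'
  else 1.

Definition path_prob (sigma : scheduler) (w : fpath) : R :=
  path_prob_from sigma [::] w.

Definition first_hit (G : pred S) (w : fpath) : bool :=
  G (path_end w) && all (predC G) (belast (minit M) (map snd w)).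

(* The event "eventually G" is the disjoint union of the cylinder sets of the
   finite paths that visit G exactly at their end. *)
Definition reach_prob (sigma : scheduler) (G : pred S) : \bar R :=
  (\sum_(0 <= n <oo)
     (\sum_(w : n.-tuple (A * S) | first_hit G w) path_prob sigma w)%R%:E)%E.

Definition max_reach_prob (G : pred S) : \bar R :=
  ereal_sup [set x | exists2 sigma, is_scheduler sigma & x = reach_prob sigma G]%classic.

Definition min_reach_prob (G : pred S) : \bar R :=
  ereal_inf [set x | exists2 sigma, is_scheduler sigma & x = reach_prob sigma G]%classic.

End MDPTheory.

Section PCFP.
Variables (R : realType) (Loc Var : finType).

Record branch := Branch {
  bprob : R;
  bupd : update Var;
  btgt : Loc
}.

Record command := Command {
  csrc : Loc;
  cguard : bexp Var;
  cbranches : seq branch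
}.

Definition dom_val (dom : Var -> {fset int}) : finType :=
  {dffun forall x : Var, dom x}.

Definition raw_val (dom : Var -> {fset int}) (nu : dom_val dom) : Var -> int :=
  fun x => fsval (nu x).

(* The element of [dom_val dom] with underlying valuation [nu], if any. *)
Definition to_dom (dom : Var -> {fset int}) (nu : Var -> int) :
    option (dom_val dom) :=
  [pick d : dom_val dom | [forall x, raw_val d x == nu x]].

(* Commands are counted with multiplicity and their order is immaterial. *)
Record pcfp := PCFP {
  pdom : Var -> {fset int};
  pcmds : seq command;
  pinit_loc : Loc;
  pinit_val : dom_val pdom
}.

Definition is_distr (bs : seq branch) : Prop :=
  all (fun b => 0 <= bprob b) bs /\ \sum_(b <- bs) bprob b = 1.

(* [None] is the state bottom. *)
Definition sem_state (P : pcfp) : finType := option (Loc * dom_val (pdom P))%type.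

Definition sem_act (P : pcfp) : finType := 'I_(size (pcmds P)).

Definition sem_cmd (P : pcfp) (a : sem_act P) : command :=
  tnth (in_tuple (pcmds P)) a.

Definition is_pcfp (P : pcfp) : Prop :=
  forall a : sem_act P, is_distr (cbranches (sem_cmd a)).

Definition sem_avail (P : pcfp) (s : sem_state P) (a : sem_act P) : bool :=
  if s is Some (l, nu) then
    (csrc (sem_cmd a) == l) && beval (raw_val nu) (cguard (sem_cmd a))
  else false.

Definition sem_succ (P : pcfp) (nu : dom_val (pdom P)) (b : branch) : sem_state P :=
  omap (pair (btgt b)) (to_dom (pdom P) (upd (bupd b) (raw_val nu))).

Definition sem_branch (P : pcfp) (s : sem_state P) (a : sem_act P) :
    seq (R * sem_state P) :=
  if s is Some (_, nu) then
    [seq (bprob b, sem_succ nu b) | b <- cbranches (sem_cmd a)]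
  else [::].

Definition sem (P : pcfp) : mdp R :=
  {| mstate := sem_state P;
     mact := sem_act P;
     minit := Some (pinit_loc P, pinit_val P);
     mavail := @sem_avail P;
     mbranch := @sem_branch P |}.

Definition well_formed (P : pcfp) : Prop :=
  ~ @reachable R (sem P) (None : sem_state P).

Definition loc_unreachable (P : pcfp) (l : Loc) : Prop :=
  forall nu : dom_val (pdom P), ~ @reachable R (sem P) (Some (l, nu) : sem_state P).

(* The part, relevant at [l], of the convention that every state of an MDP has
   an available action.  It cannot be dropped: eliminating a transition into a
   location without commands deletes the other branches of its command. *)
Definition nonblocking_at (P : pcfp) (l : Loc) : Prop :=
  forall nu : dom_val (pdom P),
    @reachable R (sem P) (Some (l, nu) : sem_state P) ->
    exists a : sem_act P, sem_avail (Some (l, nu) : sem_state P) a.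

Definition enters (l : Loc) (c : command) : bool :=
  has (fun b => btgt b == l) (cbranches c).

Definition has_self_loop (P : pcfp) (l : Loc) : bool :=
  has (fun c => (csrc c == l) && enters l c) (pcmds P).

Definition has_transition_to (P : pcfp) (l : Loc) : bool :=
  has (enters l) (pcmds P).

Section Goals.
Variables (Lab : finType) (P : pcfp) (L : Loc -> Lab -> int)
  (theta : bexp (Var + Lab)%type).

Definition goal : pred (sem_state P) := fun s =>
  if s is Some (l, nu) then
    beval (fun z => match z with inl x => raw_val nu x | inr y => L l y end) theta
  else false.

Definition label_subst (l : Loc) (z : Var + Lab) : aexp Var :=
  match z with inl x => AVar x | inr y => AConst Var (L l y) end.

Definition potential_goal (l : Loc) : Prop :=
  exists nu : dom_val (pdom P), beval (raw_val nu) (bsubst (label_subst l) theta).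

Definition max_goal_prob : \bar R := @max_reach_prob R (sem P) goal.
Definition min_goal_prob : \bar R := @min_reach_prob R (sem P) goal.

End Goals.

Definition set_cmds (P : pcfp) (cs : seq command) : pcfp :=
  {| pdom := pdom P; pcmds := cs;
     pinit_loc := pinit_loc P; pinit_val := pinit_val P |}.

(* The command that replaces [c] for the command [d] at the target of the
   eliminated branch [b] of [c]; [rest] lists the other branches of [c]. *)
Definition elim_cmd (c : command) (b : branch) (rest : seq branch) (d : command) :
    command :=
  {| csrc := csrc c;
     cguard := BAnd (cguard c) (wp (bupd b) (cguard d));
     cbranches := rest ++
       [seq Branch (bprob b * bprob e) (UChain (bupd b) (bupd e)) (btgt e)
       | e <- cbranches d] |}.

Variant elim_step (l : Loc) (P Q : pcfp) : Prop :=
  ElimStep (cs1 : seq command) (c : command) (cs2 : seq command)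
    (bs1 : seq branch) (b : branch) (bs2 : seq branch) of
    pcmds P = cs1 ++ c :: cs2 &
    cbranches c = bs1 ++ b :: bs2 &
    btgt b = l &
    Q = set_cmds P (cs1 ++ cs2 ++
          [seq elim_cmd c b (bs1 ++ bs2) d | d <- pcmds P & csrc d == l]).

(* No infinite run, whichever transition is eliminated in each iteration. *)
Definition elimination_terminates (l : Loc) (P : pcfp) : Prop :=
  Acc (fun Q' Q => elim_step l Q Q') P.

Definition elimination_result (l : Loc) (P P' : pcfp) : Prop :=
  clos_refl_trans pcfp (elim_step l) P P' /\ ~~ has_transition_to P' l.

End PCFP.

(* Main.v *)
(* Both optimal reachability probabilities equal the value of the initial state,
   the supremum of the value iteration started at 0, which is the least fixpoint
   of the Bellman operator; for the minimum this uses that the memoryless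
   scheduler that is greedy for the value never exceeds it.

   Let Q arise from P by eliminating a branch b of a command c.  On a state from
   which b leads to (l, nu), with l not a goal, the Bellman equation at (l, nu)
   says that the action c of P is worth exactly the optimum over the commands of
   Q that replace c.  Hence, on the states reachable in P, the value function of
   P solves the Bellman equations of Q and conversely; as each is least for its
   own program, they agree there. *)
Require Import Defs.
From HB Require Import structures.
From mathcomp Require Import all_boot all_order all_algebra finmap.
From mathcomp Require Import all_classical all_reals all_analysis.
From Stdlib Require Import Relation_Operators.
From Stdlib Require List.

Set Implicit Arguments.
Unset Strict Implicit.
Unset Printing Implicit Defensive.

Import Order.TTheory GRing.Theory Num.Theory.

Local Open Scope ring_scope.

(** Serves to split sums over paths at their first step. *)
Lemma big_tuple_cons (R : nmodType) (T : finType) n (P : pred (seq T))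
    (F : seq T -> R) :
  \sum_(w : n.+1.-tuple T | P w) F w =
  \sum_(e : T) \sum_(w : n.-tuple T | P (e :: w)) F (e :: w).
Proof.
pose h (p : T * n.-tuple T) := cons_tuple p.1 p.2.
pose g (w : n.+1.-tuple T) := (thead w, [tuple of behead w]).
rewrite pair_big_dep (reindex h) //=.
exists g => [[x w] _ | w _]; rewrite /g /h /=.
  by congr pair; apply: val_inj.
by rewrite [RHS]tuple_eta.
Qed.

(** * Maxima and minima over a possibly empty set of choices *)

Section Optimum.
Variable R : realDomainType.

(** The flag [mx] selects maximisation or minimisation, so that both optima share almost all
    proofs. *)
Definition better (mx : bool) : rel R :=
  fun x y => if mx then y <= x else x <= y.

Lemma better_refl mx : reflexive (better mx).
Proof. by case: mx => x; apply: lexx. Qed.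

Lemma better_trans mx : transitive (better mx).
Proof. by case: mx => y x z /= xy yz; [apply: le_trans yz xy | apply: le_trans xy yz]. Qed.

Lemma better_total mx : total (better mx).
Proof. by case: mx => x y /=; [rewrite orbC|]; exact: le_total. Qed.

(* A run blocked outside the goal never reaches it, whence the value 0 when
   there is no choice. *)
Definition opt_spec (mx : bool) (T : Type) (C : T -> Prop) (f : T -> R) (x : R) :=
  (exists c, [/\ C c, x = f c & forall c', C c' -> better mx x (f c')]) \/
  ((forall c, ~ C c) /\ x = 0).

(** For the maximum, [f] and [g] are compared at an optimal choice for [f]; for the minimum, at one
    for [g]. *)
Lemma opt_le mx (T : Type) (C : T -> Prop) f g x y e : 0 <= e ->
  opt_spec mx C f x -> opt_spec mx C g y ->
  (forall c, C c -> f c <= g c + e) -> x <= y + e.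
Proof.
move=> e0 [[c [Cc -> fo]]|[nC ->]] [[d [Cd -> go]]|[nC' ->]] fg.
- case: mx fo go => /= fo go.
    by apply: le_trans (fg _ Cc) _; rewrite lerD2r go.
  exact: le_trans (fo _ Cd) (fg _ Cd).
- by case: (nC' c).
- by case: (nC d).
- by rewrite add0r.
Qed.

(** An optimum depends only on the set of attained values, which the two hypotheses equate. *)
Lemma opt_transfer mx (T U : Type) (C : T -> Prop) (D : U -> Prop) f g x :
  (forall c, C c -> exists2 d, D d & g d = f c) ->
  (forall d, D d -> exists2 c, C c & g d = f c) ->
  opt_spec mx C f x -> opt_spec mx D g x.
Proof.
move=> CD DC [[c [Cc -> fo]]|[nC ->]].
  have [d Dd gd] := CD _ Cc; left; exists d; split=> // d' /DC [c' Cc' ->].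
  exact: fo.
by right; split=> // d /DC [c /nC].
Qed.

(** Abstract form of an elimination: [c] is the removed command, [A] says that it is enabled, and
    [E] holds of its enabled replacements. [E] has to be inhabited under [A]: were [f c] only the
    default 0, dropping [c] could raise a minimum. *)
Lemma opt_replace mx (T : Type) (D E : T -> Prop) (A : Prop) (c : T) f x :
  (forall e, E e -> A) ->
  (A -> (exists e, E e) /\ opt_spec mx E f (f c)) ->
  opt_spec mx (fun d => D d \/ (A /\ d = c)) f x <->
  opt_spec mx (fun d => D d \/ E d) f x.
Proof.
move=> EA AE; split.
  case=> [[d [Cd -> fo]]|[nC ->]]; last first.
    right; split=> // d [Dd|Ed]; first by apply: (nC d); left.
    by apply: (nC c); right; split=> //; apply: EA Ed.
  have fo' d' : D d' \/ E d' -> better mx (f d) (f d').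
    case=> [Dd|Ed]; first by apply: fo; left.
    have Ah := EA _ Ed.
    case: (AE Ah) => _ [[e [Ee fce fe]]|[nE]]; last by case: (nE d').
    by apply: better_trans (fe _ Ed); apply: fo; right.
  case: Cd => [Dd|[Ah dc]].
    by left; exists d; split=> //; left.
  case: (AE Ah) => [[e0 Ee0]] [[e [Ee fce fe]]|[nE]]; last by case: (nE e0).
  left; exists e; rewrite -fce -dc; split=> //; by right.
case=> [[d [Cd -> fo]]|[nC ->]]; last first.
  right; split=> // d [Dd|[Ah _]]; first by apply: (nC d); left.
  by case: (AE Ah) => [[e0 Ee0]] _; apply: (nC e0); right.
have fo' d' : D d' \/ A /\ d' = c -> better mx (f d) (f d').
  case=> [Dd|[Ah ->]]; first by apply: fo; left.
  case: (AE Ah) => [[e0 Ee0]] [[e [Ee fce fe]]|[nE]]; last by case: (nE e0).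
  by rewrite fce; apply: fo; right.
case: Cd => [Dd|Ed]; first by left; exists d; split=> //; left.
have Ah := EA _ Ed.
left; exists c; case: (AE Ah) => _ [[e [Ee fce fe]]|[nE]]; last by case: (nE d).
(* [f c] is optimal over [E], which contains [d], and [d] is optimal overall, so each is at least as
   good as the other. *)
have fdc : f d = f c.
  have h1 := fe _ Ed; have h2 : better mx (f d) (f c) by apply: fo'; right.
  apply/eqP; rewrite eq_le; case: (mx) h1 h2 => /= h1 h2; by rewrite h1 h2.
split=> //; first by right.
Qed.

(** A map [r + p * _] with [p >= 0] preserves the order and hence the optimal choice, but not the
    default 0, whence the demand for some choice. *)
Lemma opt_affine mx (T : Type) (C : T -> Prop) (f : T -> R)
    (r p x : R) : 0 <= p -> (exists c, C c) ->
  opt_spec mx C f x -> opt_spec mx C (fun c => r + p * f c) (r + p * x).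
Proof.
move=> p0 [c0 C0] [[c [Cc -> fo]]|[nC]]; last by case: (nC c0).
left; exists c; split=> // c' /fo; rewrite /better.
by case: mx {fo} => ?; rewrite lerD2l ler_wpM2l.
Qed.

Lemma opt_iff mx (T : Type) (C D : T -> Prop) (f : T -> R) x :
  (forall c, C c <-> D c) -> opt_spec mx C f x -> opt_spec mx D f x.
Proof. by move=> CD; apply: opt_transfer => c /CD cc; exists c. Qed.

End Optimum.

(** * Value iteration and optimal reachability *)

Section Bellman.
Variables (R : realType) (M : mdp R) (G : pred (mstate M)).
Local Notation S := (mstate M).
Local Notation A := (mact M).
Implicit Types (U W : S -> R) (s t : S) (a : A) (mx : bool).

Definition aval U s a : R := \sum_(b <- mbranch M s a) b.1 * U b.2.

Definition opt_act mx U s : option A :=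
  if [pick a | mavail M s a] is Some a0 then
    Some (extremum (better mx) a0 (mavail M s) (aval U s))
  else None.

Definition opt_val mx U s : R := if opt_act mx U s is Some a then aval U s a else 0.

Definition bellman mx U s : R := if G s then 1 else opt_val mx U s.

(** The Bellman equation as a relation that names no chosen action, so that it can be carried over
    to a program with other actions. *)
Definition bellman_at mx U s x : Prop :=
  if G s then x = 1 else opt_spec mx (fun a => mavail M s a) (aval U s) x.

Lemma opt_actP mx U s :
  if opt_act mx U s is Some a
  then mavail M s a /\
    (forall a', mavail M s a' -> better mx (aval U s a) (aval U s a'))
  else forall a, ~~ mavail M s a.
Proof.
rewrite /opt_act; case: pickP => [a0 a0s|na]; last by move=> a; rewrite na.
case: (extremumP (ord := better mx) (P := mavail M s) (aval U s)) => //.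
- exact: better_refl.
- exact: better_trans.
- exact: better_total.
Qed.

Lemma bellmanP mx U s : bellman_at mx U s (bellman mx U s).
Proof.
rewrite /bellman /bellman_at; case: (G s) => //.
rewrite /opt_val; case: (opt_act mx U s) (opt_actP mx U s) => [a [av best]|na].
  by left; exists a.
by right; split=> // a; apply/negP.
Qed.

Definition viter mx n := iter n (bellman mx) (fun=> 0).

Definition value mx s : R := sup (range (fun n => viter mx n s)).

Definition edge s t : Prop := exists a p, mavail M s a /\ (p, t) \in mbranch M s a.

Definition substochastic : Prop :=
  forall s a, (forall b, b \in mbranch M s a -> 0 <= b.1) /\
    \sum_(b <- mbranch M s a) b.1 <= 1.

Hypothesis Mss : substochastic.

Lemma aval_le U W s a e : 0 <= e ->
  (forall p t, (p, t) \in mbranch M s a -> U t <= W t + e) ->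
  aval U s a <= aval W s a + e.
Proof.
move=> e0 UW; have [p0 p1] := Mss s a.
apply: (@le_trans _ _ (\sum_(b <- mbranch M s a) (b.1 * W b.2 + b.1 * e))).
  rewrite /aval big_seq [leRHS]big_seq; apply: ler_sum => -[p t] bin /=.
  by rewrite -mulrDr; apply: ler_wpM2l; [apply: p0 bin | apply: UW bin].
rewrite big_split lerD2l -mulr_suml; exact: ler_piMl.
Qed.

Lemma aval_ge0 U s a : (forall t, 0 <= U t) -> 0 <= aval U s a.
Proof.
move=> U0; have [p0 p1] := Mss s a; rewrite /aval big_seq.
by apply: sumr_ge0 => b /p0 ?; apply: mulr_ge0.
Qed.

(** Monotonicity ([e = 0]) and non-expansiveness of the Bellman operator in one statement; only
    successors of [s] have to be compared. *)
Lemma bellman_at_le mx U W s x y e : 0 <= e ->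
  (forall t, edge s t -> U t <= W t + e) ->
  bellman_at mx U s x -> bellman_at mx W s y -> x <= y + e.
Proof.
move=> e0 UW; rewrite /bellman_at; case: (G s).
  by move=> -> ->; rewrite lerDl.
move=> Ux Wy; apply: (opt_le e0 Ux Wy) => a av; apply: aval_le => // p t pt.
by apply: UW; exists a, p.
Qed.

Lemma bellman_ge0 mx U s : (forall t, 0 <= U t) -> 0 <= bellman mx U s.
Proof.
move=> U0; have := bellmanP mx U s; rewrite /bellman_at.
case: (G s) => [->//|[[a [_ -> _]]|[_ ->]//]]; exact: aval_ge0.
Qed.

Lemma viter_ge0 mx n s : 0 <= viter mx n s.
Proof. by elim: n s => [|n IH] s //=; apply: bellman_ge0. Qed.

(** As [good] is closed under edges, the induction never leaves it, so the equations for [U] have to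
    hold only there. This allows a restriction to reachable states. *)
Lemma viter_le_fix (good : S -> Prop) mx U :
  (forall s t, good s -> edge s t -> good t) ->
  (forall s, good s -> 0 <= U s) ->
  (forall s, good s -> bellman_at mx U s (U s)) ->
  forall n s, good s -> viter mx n s <= U s.
Proof.
move=> gc U0 Ufix; elim=> [|n IH] s gs /=; first exact: U0.
rewrite -[U s]addr0; apply: bellman_at_le (bellmanP _ _ _) (Ufix _ gs) => //.
by move=> t st; rewrite addr0; apply: IH; apply: gc st.
Qed.

Lemma viter_le1 mx n s : viter mx n s <= 1.
Proof.
elim: n s => [|n IH] s //=.
have := bellmanP mx (viter mx n) s; rewrite /bellman_at.
case: (G s) => [->//|[[a [_ -> _]]|[_ ->]//]].
have [p0 p1] := Mss s a; apply: le_trans p1.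
rewrite /aval big_seq [leRHS]big_seq; apply: ler_sum => b /p0 b0.
exact: ler_piMr.
Qed.

Lemma viterS mx n s : viter mx n s <= viter mx n.+1 s.
Proof.
elim: n s => [|n IH] s; first exact: viter_ge0.
rewrite -[leRHS]addr0; apply: bellman_at_le (bellmanP _ _ _) (bellmanP _ _ _) => //.
by move=> t _; rewrite addr0.
Qed.

Lemma viter_mono mx m n s : (m <= n)%N -> viter mx m s <= viter mx n s.
Proof.
move=> /subnK <-; elim: (n - m)%N => [|k IH] //.
by apply: le_trans IH _; rewrite addSn; exact: viterS.
Qed.

Lemma has_sup_viter mx s : has_sup (range (fun n => viter mx n s)).
Proof.
by split; [exists (viter mx 0 s), 0%N | exists 1 => _ [n _ <-]; exact: viter_le1].
Qed.

Lemma viter_le_value mx n s : viter mx n s <= value mx s.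
Proof. by apply: ub_le_sup; [case: (has_sup_viter mx s) | exists n]. Qed.

Lemma value_le mx s x : (forall n, viter mx n s <= x) -> value mx s <= x.
Proof.
move=> h; apply: ge_sup; first by case: (has_sup_viter mx s).
by move=> _ [n _ <-].
Qed.

Lemma value_ge0 mx s : 0 <= value mx s.
Proof. by apply: le_trans (viter_le_value mx 0 s). Qed.

Lemma value_approx mx e : 0 < e -> exists n, forall s, value mx s <= viter mx n s + e.
Proof.
move=> e0.
have /choice [N HN] s : exists n, value mx s <= viter mx n s + e.
  have [_ [n _ <-] h] := sup_adherent e0 (has_sup_viter mx s).
  by exists n; rewrite -lerBlDr ltW.
(* There are finitely many states and the iterates increase, so the largest index serves for all. *)
exists (\max_s N s)%N => s; apply: le_trans (HN s) _.
by rewrite lerD2r; apply: viter_mono; apply: leq_bigmax.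
Qed.

Lemma value_fix mx s : bellman mx (value mx) s = value mx s.
Proof.
apply/eqP; rewrite eq_le; apply/andP; split.
  (* The value is uniformly within [e] of some iterate, and the operator does not enlarge this
     error. *)
  apply/ler_addgt0Pr => e e0; have [n vn] := value_approx mx e0.
  apply: (@le_trans _ _ (viter mx n.+1 s + e)); last by rewrite lerD2r viter_le_value.
  exact: bellman_at_le (ltW e0) _ (bellmanP _ _ _) (bellmanP _ _ _).
apply: value_le => -[|n]; first by apply: bellman_ge0; exact: value_ge0.
rewrite -[leRHS]addr0; apply: bellman_at_le (bellmanP _ _ _) (bellmanP _ _ _) => //.
by move=> t _; rewrite addr0; exact: viter_le_value.
Qed.

Lemma value_at mx s : bellman_at mx (value mx) s (value mx s).
Proof. by rewrite -[X in bellman_at _ _ _ X]value_fix; exact: bellmanP. Qed.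

Lemma value_le_fix (good : S -> Prop) mx U :
  (forall s t, good s -> edge s t -> good t) ->
  (forall s, good s -> 0 <= U s) ->
  (forall s, good s -> bellman_at mx U s (U s)) ->
  forall s, good s -> value mx s <= U s.
Proof. by move=> gc U0 Uf s gs; apply: value_le => n; apply: viter_le_fix gs. Qed.

(** * Reachability under a fixed scheduler *)

Section Scheduler.
Variable sigma : scheduler M.
Hypothesis sch : is_scheduler sigma.

(** The probability that, once [h] has been run, the goal is met after fewer than [n] further steps;
    the recursion parallels [viter], with histories for states. *)
Fixpoint hit_prob n (h : Defs.fpath M) : R :=
  if n is m.+1 then
    if G (path_end h) then 1 else
      \sum_(e : A * S) sigma h e.1 * mprob (path_end h) e.1 e.2 * hit_prob m (rcons h e)
  else 0.

Lemma path_end_rcons (h : Defs.fpath M) e : path_end (rcons h e) = e.2.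
Proof. by rewrite /path_end map_rcons last_rcons. Qed.

Lemma mprob_ge0 s a t : 0 <= mprob s a t.
Proof.
rewrite /mprob big_seq_cond; apply: sumr_ge0 => b /andP[bin _].
by have [p0 _] := Mss s a; apply: p0.
Qed.

Lemma path_prob_from_ge0 h w : 0 <= path_prob_from sigma h w.
Proof.
elim: w h => [|e w IH] h //=; apply: mulr_ge0 => //; apply: mulr_ge0.
  by have [] := sch h.
exact: mprob_ge0.
Qed.

Definition first_hit_from s (w : Defs.fpath M) : bool :=
  G (last s (map snd w)) && all (predC G) (belast s (map snd w)).

(** First-hit paths are split at their first step: the empty path counts exactly when the goal
    already holds, longer ones only when it does not. *)
Lemma hit_probE n h :
  \sum_(0 <= k < n) \sum_(w : k.-tuple (A * S) | first_hit_from (path_end h) w)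
    path_prob_from sigma h w = hit_prob n h.
Proof.
elim: n h => [|n IH] h; first by rewrite big_geq.
rewrite big_nat_recl //=.
have -> : \sum_(w : 0.-tuple (A * S) | first_hit_from (path_end h) w)
   path_prob_from sigma h w = (G (path_end h))%:R.
  rewrite big_mkcond (big_pred1 [tuple]) /=; last first.
    by move=> w; apply/esym/eqP; exact: tuple0.
  by rewrite /first_hit_from /= andbT; case: (G _).
have big_step k : \sum_(w : k.+1.-tuple (A * S) | first_hit_from (path_end h) w)
    path_prob_from sigma h w =
   \sum_(e : A * S) \sum_(w : k.-tuple (A * S) | ~~ G (path_end h) && first_hit_from e.2 w)
     sigma h e.1 * mprob (path_end h) e.1 e.2 * path_prob_from sigma (rcons h e) w.
  rewrite (big_tuple_cons k (first_hit_from (path_end h)) (path_prob_from sigma h)).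
  apply: eq_bigr => e _; apply: eq_bigl => w.
  by rewrite /first_hit_from /= andbCA.
under eq_bigr do rewrite big_step.
case: (G _) => /=.
  rewrite big1 ?addr0 // => k _; rewrite big1 // => e _; exact: big_pred0.
rewrite add0r exchange_big /=.
apply: eq_bigr => e _ /=.
rewrite -IH path_end_rcons; move: (_ * mprob _ _ _) => c.
rewrite mulr_sumr; apply: eq_bigr => k _.
by rewrite mulr_sumr.
Qed.

Lemma avalE U s a : aval U s a = \sum_t mprob s a t * U t.
Proof.
rewrite /aval /mprob; under [RHS]eq_bigr do rewrite mulr_suml.
rewrite (exchange_big_dep predT) //=; apply: eq_bigr => b _.
by rewrite (big_pred1 b.2) // => t; rewrite eq_sym.
Qed.

Lemma sum_aval h U :
  \sum_(e : A * S) sigma h e.1 * mprob (path_end h) e.1 e.2 * U e.2 =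
  \sum_a sigma h a * aval U (path_end h) a.
Proof.
under [RHS]eq_bigr do rewrite avalE mulr_sumr.
rewrite pair_big; apply: eq_bigr => -[a t] _ /=; exact: esym (mulrA _ _ _).
Qed.

Lemma sigma_mprob_ge0 h (e : A * S) :
  0 <= sigma h e.1 * mprob (path_end h) e.1 e.2.
Proof. by apply: mulr_ge0; [have [] := sch h | exact: mprob_ge0]. Qed.

(** A scheduler averages over the available actions, and an average does not exceed the maximum. *)
Lemma hit_prob_le_value n h : hit_prob n h <= value true (path_end h).
Proof.
elim: n h => [|n IH] h /=; first exact: value_ge0.
have := value_at true (path_end h); rewrite /bellman_at.
case: (G _) => [->//|opt].
apply: (@le_trans _ _ (\sum_a sigma h a * aval (value true) (path_end h) a)).
  rewrite -sum_aval; apply: ler_sum => e _; apply: ler_wpM2l.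
    exact: sigma_mprob_ge0.
  by rewrite -[e.2](path_end_rcons h).
have [s0 sna s1] := sch h.
case: opt => [[a [av -> best]]|[na ->]]; last first.
  by rewrite big1 // => a _; rewrite sna ?mul0r //; apply/negP.
rewrite -[leRHS]mul1r -s1; last by exists a.
rewrite mulr_suml; apply: ler_sum => b _.
have [bv|nbv] := boolP (mavail M (path_end h) b); last by rewrite sna ?mul0r.
by apply: ler_wpM2l => //; apply: best.
Qed.

(** An average is at least the minimum. The bound is an iterate, since within a finite horizon the
    probability may still lie below the value. *)
Lemma viter_le_hit_prob n h : viter false n (path_end h) <= hit_prob n h.
Proof.
elim: n h => [|n IH] h //=.
have := bellmanP false (viter false n) (path_end h); rewrite /bellman_at.
case: (G _) => [->//|opt].
apply: (@le_trans _ _ (\sum_a sigma h a * aval (viter false n) (path_end h) a)); last first.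
  rewrite -sum_aval; apply: ler_sum => e _; apply: ler_wpM2l.
    exact: sigma_mprob_ge0.
  by rewrite -[e.2](path_end_rcons h).
have [s0 sna s1] := sch h.
case: opt => [[a [av -> best]]|[na ->]]; last first.
  by rewrite big1 // => a _; rewrite sna ?mul0r //; apply/negP.
rewrite -[leLHS]mul1r -s1; last by exists a.
rewrite mulr_suml; apply: ler_sum => b _.
have [bv|nbv] := boolP (mavail M (path_end h) b); last by rewrite sna ?mul0r.
by apply: ler_wpM2l => //; apply: best.
Qed.

Local Notation term k :=
  ((\sum_(w : k.-tuple (A * S) | first_hit G w) path_prob sigma w)%R%:E)%E.

Lemma term_ge0 k : (0 <= term k)%E.
Proof. by rewrite lee_fin; apply: sumr_ge0 => w _; exact: path_prob_from_ge0. Qed.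

Lemma partial_hit_prob n : (\sum_(0 <= k < n) term k)%E = (hit_prob n [::])%:E.
Proof. by rewrite -hit_probE sumEFin. Qed.

Lemma hit_prob_le_reach n : ((hit_prob n [::])%:E <= reach_prob sigma G)%E.
Proof.
rewrite -partial_hit_prob; apply: nneseries_lim_ge => k _ _; exact: term_ge0.
Qed.

Lemma reach_prob_le x :
  (forall n, hit_prob n [::] <= x) -> (reach_prob sigma G <= x%:E)%E.
Proof.
move=> hx; apply: lime_le.
  by apply: is_cvg_nneseries => k _ _; exact: term_ge0.
by apply: nearW => n; rewrite partial_hit_prob lee_fin.
Qed.

End Scheduler.

(** * Greedy schedulers and the optimal probabilities *)

Section Greedy.
Variables (mx : bool) (U : nat -> S -> R).

(** Indexing [U] by time covers both finite-horizon schedulers and, for constant [U], the memoryless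
    one. *)
Definition greedy : scheduler M :=
  fun h a => (opt_act mx (U (size h)) (path_end h) == Some a)%:R.

Lemma greedy_scheduler : is_scheduler greedy.
Proof.
move=> h; have := opt_actP mx (U (size h)) (path_end h).
rewrite /greedy; case: (opt_act _ _ _) => [a [av _]|na]; split=> //.
- move=> b nb; case: eqP => [[ab]|//]; by rewrite -ab av in nb.
- move=> _; rewrite (bigD1 a) //= eqxx big1 ?addr0 // => b ba.
  by rewrite (inj_eq Some_inj) eq_sym (negbTE ba).
- by case=> a; rewrite (negbTE (na a)).
Qed.

Lemma greedy_sum h W :
  \sum_a greedy h a * aval W (path_end h) a =
  if opt_act mx (U (size h)) (path_end h) is Some a then aval W (path_end h) a else 0.
Proof.
rewrite /greedy; case: (opt_act _ _ _) => [a|]; last by rewrite big1 // => a _; rewrite mul0r.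
rewrite (bigD1 a) //= eqxx mul1r big1 ?addr0 // => b ba.
by rewrite (inj_eq Some_inj) eq_sym (negbTE ba) mul0r.
Qed.

End Greedy.

(** After [k] of [n] rounds the successors are worth the iterate of index [n - k - 1], for which the
    action must be greedy. *)
Lemma greedy_hit_prob mx n m h : (m + size h = n)%N ->
  hit_prob (greedy mx (fun k => viter mx (n - k).-1)) m h = viter mx m (path_end h).
Proof.
elim: m h => [|m IH] h //= mh; rewrite /bellman; case: (G _) => //.
rewrite (eq_bigr (fun e => greedy mx (fun k => viter mx (n - k).-1) h e.1 *
   mprob (path_end h) e.1 e.2 * viter mx m e.2)); last first.
  by move=> e _; rewrite IH ?path_end_rcons // size_rcons addnS.
rewrite sum_aval greedy_sum /opt_val.
by rewrite (_ : (n - size h).-1 = m) // -mh addnK.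
Qed.

Lemma greedy_hit_prob_le m h :
  hit_prob (greedy false (fun=> value false)) m h <= value false (path_end h).
Proof.
elim: m h => [|m IH] h /=; first exact: value_ge0.
rewrite -value_fix /bellman; case: (G _) => //.
rewrite /opt_val -[leRHS](greedy_sum false (fun=> value false)) -sum_aval.
apply: ler_sum => e _; apply: ler_wpM2l.
  exact: sigma_mprob_ge0 (greedy_scheduler _ _) _ _.
by rewrite -[e.2](path_end_rcons h).
Qed.

(** Finite-horizon greedy schedulers reach each iterate. A scheduler greedy for the value itself
    could postpone the goal forever. *)
Lemma max_reach_probE : max_reach_prob G = (value true (minit M))%:E.
Proof.
apply/eqP; rewrite eq_le; apply/andP; split.
  apply: ge_ereal_sup => _ [sigma sch ->]; apply: reach_prob_le => // n.
  exact: hit_prob_le_value.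
have lb n : ((viter true n (minit M))%:E <= max_reach_prob G)%E.
  have sch := greedy_scheduler true (fun k => viter true (n - k).-1).
  apply: le_trans (ereal_sup_ubound _); last by eexists; first exact: sch.
  apply: le_trans (hit_prob_le_reach sch n).
  by rewrite greedy_hit_prob ?addn0.
case: (max_reach_prob G) lb => [r| |] lb; rewrite ?leey //.
  by rewrite lee_fin; apply: value_le => n; have := lb n; rewrite lee_fin.
by have := lb 0%N.
Qed.

Lemma min_reach_probE : min_reach_prob G = (value false (minit M))%:E.
Proof.
apply/eqP; rewrite eq_le; apply/andP; split.
  have sch := greedy_scheduler false (fun=> value false).
  apply: le_trans (ereal_inf_lbound _) _; first by eexists; first exact: sch.
  apply: reach_prob_le => // n; exact: greedy_hit_prob_le.
apply: le_ereal_inf_tmp => _ [sigma sch ->].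
have lb n : ((viter false n (minit M))%:E <= reach_prob sigma G)%E.
  apply: le_trans (hit_prob_le_reach sch n).
  by rewrite lee_fin; exact: (viter_le_hit_prob sch n [::]).
case: (reach_prob sigma G) lb => [r| |] lb; rewrite ?leey //.
  by rewrite lee_fin; apply: value_le => n; have := lb n; rewrite lee_fin.
by have := lb 0%N.
Qed.

End Bellman.

(** * Elimination of a transition *)

Lemma aeval_subst (V W : Type) (s : V -> aexp W) nu e :
  aeval nu (asubst s e) = aeval (fun x => aeval nu (s x)) e.
Proof.
elim: e => [x|z|k f args IH] //=.
by congr f; apply/funext => i; exact: IH.
Qed.

Lemma beval_subst (V W : Type) (s : V -> aexp W) nu b :
  beval nu (bsubst s b) = beval (fun x => aeval nu (s x)) b.
Proof.
elim: b => [k r args|b IH|b1 IH1 b2 IH2] /=.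
- by congr r; apply/funext => i; exact: aeval_subst.
- by rewrite IH.
- by rewrite IH1 IH2.
Qed.

Lemma beval_wp (V : Type) (u : update V) nu psi :
  beval nu (wp u psi) = beval (upd u nu) psi.
Proof.
elim: u nu psi => [f|u1 IH1 u2 IH2] nu psi /=; first exact: beval_subst.
by rewrite IH1 IH2.
Qed.

Lemma to_dom_raw (Var : finType) (dom : Var -> {fset int}) (nu : Var -> int) d :
  to_dom dom nu = Some d -> raw_val d = nu.
Proof.
rewrite /to_dom; case: pickP => // d' /forallP h [<-].
by apply/funext => x; apply/eqP.
Qed.

(** Commands contain functions, so their equality is decided classically; it gives membership in
    command lists. *)
HB.instance Definition _ (R : realType) (Loc Var : finType) :=
  gen_eqMixin (command R Loc Var).

(** * The semantics in terms of commands *)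

Section Semantics.
Variables (R : realType) (Loc Var : finType).
Implicit Types (P Q : pcfp R Loc Var) (c d : command R Loc Var) (l : Loc).

Lemma sem_cmd_mem P (a : sem_act P) : sem_cmd a \in pcmds P.
Proof. exact: mem_tnth. Qed.

Lemma mem_sem_cmd P c : c \in pcmds P -> exists a : sem_act P, sem_cmd a = c.
Proof. by move=> /(tnthP (in_tuple (pcmds P))) [a ->]; exists a. Qed.

Lemma is_pcfpP P : is_pcfp P <-> forall c, c \in pcmds P -> is_distr (cbranches c).
Proof.
split=> [h c /mem_sem_cmd [a <-] // | h a]; apply: h; exact: sem_cmd_mem.
Qed.

Definition enabled P l (nu : dom_val (pdom P)) c : Prop :=
  [/\ c \in pcmds P, csrc c = l & beval (raw_val nu) (cguard c)].

Definition cval P (U : sem_state P -> R) (nu : dom_val (pdom P)) c : R :=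
  \sum_(b <- cbranches c) bprob b * U (sem_succ nu b).

Lemma sem_availE P l (nu : dom_val (pdom P)) (a : sem_act P) :
  sem_avail (Some (l, nu) : sem_state P) a <-> enabled l nu (sem_cmd a).
Proof.
split=> [/andP[/eqP sl g]|[_ sl g]]; first by split=> //; exact: sem_cmd_mem.
by rewrite /= sl eqxx.
Qed.

(** Actions are positions in the command list and shift under elimination; commands can be compared
    across programs. *)
Lemma bellman_sem P (G : pred (sem_state P)) mx (U : sem_state P -> R) l nu x :
  @bellman_at R (sem P) G mx U (Some (l, nu)) x <->
  if G (Some (l, nu)) then x = 1 else opt_spec mx (enabled l nu) (cval U nu) x.
Proof.
rewrite /bellman_at /=; case: (G _) => //.
have av_cv (a : sem_act P) :
    @aval R (sem P) U (Some (l, nu)) a = cval U nu (sem_cmd a).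
  by rewrite /aval /cval /= big_map.
split; apply: opt_transfer.
- by move=> a /sem_availE av; exists (sem_cmd a).
- move=> c cen; have [a ac] : exists a : sem_act P, sem_cmd a = c.
    by apply: mem_sem_cmd; case: cen.
  exists a; last by rewrite av_cv ac.
  by apply/sem_availE; rewrite ac.
- move=> c cen; have [a ac] : exists a : sem_act P, sem_cmd a = c.
    by apply: mem_sem_cmd; case: cen.
  exists a; last by rewrite av_cv ac.
  by apply/sem_availE; rewrite ac.
- by move=> a av; exists (sem_cmd a) => //; apply/sem_availE.
Qed.

Lemma edge_sem P s t :
  @edge R (sem P) s t <->
  exists l nu c b, [/\ s = Some (l, nu), enabled l nu c,
    List.In b (cbranches c) & t = sem_succ nu b].
Proof.
split.
  case: s => [[l nu]|] [a [p [//= /sem_availE en pt]]].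
  exists l, nu, (sem_cmd a).
  have [b bin [_ tb]] : exists2 b, List.In b (cbranches (sem_cmd a)) &
      (p, t) = (bprob b, sem_succ nu b).
    elim: (cbranches _) pt => [//|b bs IH] /=; rewrite inE => /orP[/eqP ->|/IH [b' ? ?]].
      by exists b => //; left.
    by exists b' => //; right.
  by exists b.
case=> l [nu [c [b [-> en bin ->]]]].
have [a ac] : exists a : sem_act P, sem_cmd a = c by apply: mem_sem_cmd; case: en.
exists a, (bprob b); split; first by apply/sem_availE; rewrite ac.
rewrite /= ac; elim: (cbranches c) bin => [//|b' bs IH] /= [->|/IH h].
  by rewrite inE eqxx.
by rewrite inE h orbT.
Qed.

Lemma reachable_edge P s t :
  @reachable R (sem P) s -> @edge R (sem P) s t -> @reachable R (sem P) t.
Proof. by move=> rs [a [p [av pt]]]; apply: reach_step rs av pt. Qed.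

Lemma reachable_ind_edge P (good : sem_state P -> Prop) :
  good (minit (sem P)) ->
  (forall s t, good s -> @edge R (sem P) s t -> good t) ->
  forall s, @reachable R (sem P) s -> good s.
Proof.
move=> g0 gs s; elim=> // s' a p t _ gs' av pt.
by apply: gs gs' _; exists a, p.
Qed.

Lemma sem_substochastic P : is_pcfp P -> substochastic (sem P).
Proof.
move=> Pd [[l nu]|] a; last by split=> //; rewrite big_nil ler01.
have [p0 p1] := Pd a; split=> /=; last by rewrite big_map /= p1.
move=> x; elim: (cbranches _) p0 => [//|b bs IH] /= /andP[b0 /IH h].
by rewrite inE => /orP[/eqP -> //|/h].
Qed.

Definition self_loop_free P l : Prop :=
  forall c, c \in pcmds P -> csrc c = l -> ~~ enters l c.

Lemma self_loopP P l : ~ has_self_loop P l <-> self_loop_free P l.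
Proof.
split=> [h c cP /eqP cl|h /hasP [c cP /andP[/eqP cl]]]; last exact/negP/h.
by apply/negP => ce; apply: h; apply/hasP; exists c => //; rewrite cl.
Qed.

(** * A single elimination step *)

Section Step.
Variables (P : pcfp R Loc Var) (l : Loc).
Variables (cs1 cs2 : seq (command R Loc Var)) (c : command R Loc Var).
Variables (bs1 bs2 : seq (branch R Loc Var)) (b : branch R Loc Var).
Hypotheses (Pcs : pcmds P = cs1 ++ c :: cs2)
  (cbs : cbranches c = bs1 ++ b :: bs2) (bl : btgt b = l).
Hypotheses (Pdistr : is_pcfp P) (Pwf : well_formed P) (Psl : self_loop_free P l)
  (Pnb : nonblocking_at P l).

Let new d := elim_cmd c b (bs1 ++ bs2) d.
(** The domains are kept, so both programs have the same states by conversion, and one function can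
    be tested in both Bellman equations. *)
Let Q := set_cmds P (cs1 ++ cs2 ++ [seq new d | d <- pcmds P & csrc d == l]).

Lemma elim_mem_src d : (d \in pcmds P) <-> d \in cs1 ++ cs2 \/ d = c.
Proof.
rewrite Pcs !mem_cat inE; split; first by case/or3P=> [->|/eqP->|->]; [left|right|left; rewrite orbT].
by case=> [/orP[]->|->]; rewrite ?eqxx ?orbT.
Qed.

Lemma elim_mem_tgt d : (d \in pcmds Q) <->
  d \in cs1 ++ cs2 \/ exists e, [/\ e \in pcmds P, csrc e = l & d = new e].
Proof.
rewrite /= catA mem_cat; split.
  case/orP=> [|/mapP [e]]; [by left|rewrite mem_filter => /andP[/eqP el eP] ->].
  by right; exists e.
case=> [->//|[e [eP el ->]]]; apply/orP; right; apply: map_f.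
by rewrite mem_filter el eqxx.
Qed.

(** Otherwise [b] would be a self-loop. Hence the commands at [l] survive the step unchanged. *)
Lemma elim_src_neq : csrc c != l.
Proof.
apply/eqP => cl; have /negP := Psl (iffRL (elim_mem_src c) (or_intror erefl)) cl.
by apply; rewrite /enters cbs has_cat /= bl eqxx orbT.
Qed.

Lemma cval_split (U : sem_state P -> R) nu :
  cval U nu c = \sum_(b' <- bs1 ++ bs2) bprob b' * U (sem_succ nu b') +
    bprob b * U (sem_succ nu b).
Proof. by rewrite /cval cbs !big_cat big_cons /= addrCA addrC. Qed.

Lemma elim_succ (nu nu1 : dom_val (pdom P)) (p : R) e : sem_succ nu b = Some (l, nu1) ->
  sem_succ nu (Branch p (UChain (bupd b) (bupd e)) (btgt e)) = sem_succ nu1 e.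
Proof.
by rewrite /sem_succ /=; case: to_dom (@to_dom_raw _ (pdom P) (upd (bupd b) (raw_val nu)))
  => //= nu' /(_ _ erefl) <- [_ ->].
Qed.

(** Together with [cval_split], this exhibits [c] and its replacements under one affine map, applied
    to values at the intermediate state. *)
Lemma cval_new (U : sem_state P -> R) nu nu1 d : sem_succ nu b = Some (l, nu1) ->
  cval U nu (new d) = \sum_(b' <- bs1 ++ bs2) bprob b' * U (sem_succ nu b') +
    bprob b * cval U nu1 d.
Proof.
move=> s1; rewrite /cval big_cat big_map mulr_sumr /=; congr (_ + _).
by apply: eq_bigr => e _; rewrite (elim_succ _ _ s1) mulrA.
Qed.

Lemma elim_guard (nu nu1 : dom_val (pdom P)) d : sem_succ nu b = Some (l, nu1) ->
  beval (raw_val nu) (cguard (new d)) =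
  beval (raw_val nu) (cguard c) && beval (raw_val nu1) (cguard d).
Proof.
rewrite /= beval_wp /sem_succ.
by case: to_dom (@to_dom_raw _ (pdom P) (upd (bupd b) (raw_val nu)))
  => //= nu' /(_ _ erefl) <- [_ ->].
Qed.

(* Well-formedness is what keeps the first half of a chained update within
   the domains. *)
Lemma elim_mid l' (nu : dom_val (pdom P)) :
  @reachable R (sem P) (Some (l', nu)) -> enabled l' nu c ->
  exists2 nu1, sem_succ nu b = Some (l, nu1) & @reachable R (sem P) (Some (l, nu1)).
Proof.
move=> rs en; have rt : @reachable R (sem P) (sem_succ nu b).
  apply: reachable_edge rs _; apply/edge_sem; exists l', nu, c, b; split=> //.
  by rewrite cbs; elim: bs1 => [|x xs IH] /=; [left|right].
case E: (sem_succ nu b) rt => [[l1 nu1]|] rt; last by case: Pwf.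
suff <- : l1 = l by exists nu1.
by move: E; rewrite /sem_succ; case: to_dom => //= ? [<-].
Qed.

Lemma enabled_nonblocking nu : @reachable R (sem P) (Some (l, nu)) ->
  exists d, @enabled P l nu d.
Proof. by move=> /Pnb [a /sem_availE]; exists (sem_cmd a). Qed.

Lemma enabled_elim_l nu d : @enabled P l nu d <-> @enabled Q l nu d.
Proof.
have cl := elim_src_neq.
split=> -[dP dl dg]; split=> //.
  apply/elim_mem_tgt; left; case/elim_mem_src: dP => // dc.
  by rewrite -dl dc eqxx in cl.
apply/elim_mem_src; left; case/elim_mem_tgt: dP => // -[e [_ _ de]].
by rewrite -dl de eqxx in cl.
Qed.

Lemma enabled_elim_src l' nu d : @enabled P l' nu d <->
  (d \in cs1 ++ cs2 /\ csrc d = l' /\ beval (raw_val nu) (cguard d)) \/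
  (@enabled P l' nu c /\ d = c).
Proof.
split=> [[/elim_mem_src[dD|->] dl dg]|[[dD [dl dg]]|[cen ->]]] //.
- by left.
- by right; split=> //; split=> //; apply/elim_mem_src; right.
- by split=> //; apply/elim_mem_src; left.
Qed.

Lemma enabled_elim_tgt l' nu d : @enabled Q l' nu d <->
  (d \in cs1 ++ cs2 /\ csrc d = l' /\ beval (raw_val nu) (cguard d)) \/
  (exists e, [/\ e \in pcmds P, csrc e = l, d = new e, csrc c = l' &
     beval (raw_val nu) (cguard (new e))]).
Proof.
split=> [[/elim_mem_tgt[dD|[e [eP el ->]]] dl dg]|[[dD [dl dg]]|[e [eP el -> cl g]]]].
- by left.
- by right; exists e.
- by split=> //; apply/elim_mem_tgt; left.
- by split=> //; apply/elim_mem_tgt; right; exists e.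
Qed.

(** * Invariance of the Bellman equations *)

Section Values.
Variables (G : pred (sem_state P)) (mx : bool).
Hypothesis Gl : forall nu, G (Some (l, nu)) = false.

Lemma bellman_elim_l (U : sem_state P -> R) nu x :
  @bellman_at R (sem P) G mx U (Some (l, nu)) x <->
  @bellman_at R (sem Q) G mx U (Some (l, nu)) x.
Proof.
split=> /bellman_sem; rewrite Gl => h; apply/bellman_sem; rewrite Gl;
  apply: opt_transfer h => d /enabled_elim_l den; by exists d.
Qed.

Lemma bellman_elim (U : sem_state P -> R) s x :
  @reachable R (sem P) s ->
  (forall nu, @reachable R (sem P) (Some (l, nu)) ->
     @bellman_at R (sem P) G mx U (Some (l, nu)) (U (Some (l, nu)))) ->
  @bellman_at R (sem P) G mx U s x <-> @bellman_at R (sem Q) G mx U s x.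
Proof.
case: s => [[l' nu]|]; last by move=> /Pwf.
move=> rs Ul.
pose D d := d \in cs1 ++ cs2 /\ csrc d = l' /\ beval (raw_val nu) (cguard d).
pose E d := exists e, [/\ e \in pcmds P, csrc e = l, d = new e, csrc c = l' &
     beval (raw_val nu) (cguard (new e))].
have EA d : E d -> @enabled P l' nu c.
  case=> e [_ _ _ cl /andP[cg _]]; split=> //; apply/elim_mem_src; by right.
have AE : @enabled P l' nu c -> (exists e, E e) /\ opt_spec mx E (cval U nu) (cval U nu c).
  move=> cen; have [nu1 s1 r1] := elim_mid rs cen.
  have [cP cl cg] := cen.
  (* A command is enabled at the intermediate state, so at least one replacement of [c] is
     enabled. *)
  have [d1 den1] := enabled_nonblocking r1.
  have /bellman_sem := Ul _ r1; rewrite Gl => opt1.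
  have dE d : @enabled P l nu1 d -> E (new d).
    by case=> dP dl dg; exists d; split=> //; rewrite (elim_guard _ s1) cg.
  split; first by exists (new d1); exact: dE.
  have b0 : 0 <= bprob b.
    have [+ _] := (iffLR (is_pcfpP P) Pdistr) c cP.
    by rewrite cbs all_cat /= => /and3P[].
  rewrite cval_split s1.
  (* The equation at the intermediate state makes its [U]-value an optimum over the commands there;
     the affine map turns it into the worth of [c]. *)
  apply: opt_transfer (opt_affine _ b0 (ex_intro _ d1 den1) opt1).
    by move=> d den; exists (new d); [exact: dE | exact: cval_new].
  move=> _ [e [eP el -> _]]; rewrite (elim_guard _ s1) => /andP[_ eg].
  by exists e; [split|exact: cval_new].
have h := opt_replace D x EA AE.
split=> /bellman_sem hx; apply/bellman_sem; move: hx; case: (G _) => // hx.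
  suff : opt_spec mx (fun d => D d \/ E d) (cval U nu) x.
    by apply: opt_iff => d; apply: iff_sym; exact: enabled_elim_tgt.
  by apply/h; apply: opt_iff hx => d; exact: enabled_elim_src.
suff : opt_spec mx (fun d => D d \/ (@enabled P l' nu c /\ d = c)) (cval U nu) x.
  by apply: opt_iff => d; apply: iff_sym; exact: enabled_elim_src.
by apply/h; apply: opt_iff hx => d; exact: enabled_elim_tgt.
Qed.

End Values.

(** An edge of [Q] is either an edge of [P] or two consecutive edges of [P] through [l]. *)
Lemma edge_elim s t : @reachable R (sem P) s -> @edge R (sem Q) s t ->
  @reachable R (sem P) t.
Proof.
move=> rs /edge_sem [l' [nu [d [e [sE /enabled_elim_tgt den ed ->]]]]].
rewrite {s}sE in rs.
case: den => [den|[f [fP fl dE cl g]]].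
  apply: reachable_edge rs _; apply/edge_sem; exists l', nu, d, e; split=> //.
  by apply/enabled_elim_src; left.
rewrite {d}dE /= in ed.
have cen : @enabled P l' nu c.
  by case/andP: g => cg _; split=> //; apply/elim_mem_src; right.
have [nu1 s1 r1] := elim_mid rs cen.
have [ed'|[e' e'f <-]] : List.In e (bs1 ++ bs2) \/ exists2 e', List.In e' (cbranches f) &
    Branch (bprob b * bprob e') (UChain (bupd b) (bupd e')) (btgt e') = e.
  elim: (bs1 ++ bs2) ed => [|x xs IH] /=.
    elim: (cbranches f) => //= x xs IH [<-|/IH [//|[e' ? ?]]].
      by right; exists x => //; left.
    by right; exists e' => //; right.
  by case=> [->|/IH [?|?]]; [left; left|left; right|right].
- apply: reachable_edge rs _; apply/edge_sem; exists l', nu, c, e; split=> //.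
  rewrite cbs; elim: bs1 ed' => [|x xs IH] /=; first by right.
  by case=> [->|/IH ?]; [left|right].
apply: reachable_edge r1 _; apply/edge_sem; exists l, nu1, f, e'; split=> //.
  by split=> //; move: g; rewrite (elim_guard _ s1) => /andP[].
exact: (elim_succ (bprob b * bprob e') e' s1).
Qed.

Lemma reachable_elim s : @reachable R (sem Q) s -> @reachable R (sem P) s.
Proof. by apply: reachable_ind_edge; [exact: reach_init | exact: edge_elim]. Qed.

Lemma elim_well_formed : well_formed Q.
Proof. by move=> /reachable_elim. Qed.

Lemma elim_self_loop_free : self_loop_free Q l.
Proof.
move=> d /elim_mem_tgt[dD|[e [_ _ ->]]] dl.
  by apply: Psl => //; apply/elim_mem_src; left.
by have := elim_src_neq; rewrite -dl eqxx.
Qed.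

Lemma elim_nonblocking : nonblocking_at Q l.
Proof.
move=> nu /reachable_elim /enabled_nonblocking [d /enabled_elim_l den].
have [a ad] : exists a : sem_act Q, sem_cmd a = d by apply: mem_sem_cmd; case: den.
by exists a; apply/sem_availE; rewrite ad.
Qed.

Lemma elim_is_pcfp : is_pcfp Q.
Proof.
apply/is_pcfpP => d /elim_mem_tgt[dD|[e [eP _ ->]]].
  by move/is_pcfpP: Pdistr; apply; apply/elim_mem_src; left.
have [c0 c1] : is_distr (cbranches c).
  by move/is_pcfpP: Pdistr; apply; apply/elim_mem_src; right.
have [e0 e1] : is_distr (cbranches e) by move/is_pcfpP: Pdistr; apply.
move: c0 c1; rewrite cbs all_cat !big_cat big_cons /= => /and3P[p1 p0 p2] c1.
split; rewrite /= ?all_cat ?p1 ?p2 /=.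
  rewrite all_map; elim: (cbranches e) e0 => //= x xs IH /andP[x0 /IH ->].
  by rewrite mulr_ge0.
(* The branches of [e] sum to 1, so they only redistribute the mass of [b]. *)
by rewrite !big_cat big_map -mulr_sumr e1 mulr1 -c1 /= addrA addrAC.
Qed.

Lemma value_elim G mx : (forall nu, G (Some (l, nu)) = false) ->
  @value R (sem P) G mx (minit (sem P)) = @value R (sem Q) G mx (minit (sem Q)).
Proof.
move=> Gl; have Pss := sem_substochastic Pdistr.
have Qss := sem_substochastic elim_is_pcfp.
apply/eqP; rewrite eq_le; apply/andP; split.
  (* In both directions the closed set is that of the states reachable in [P], which edges of [Q] do
     not leave either. *)
  apply: (@value_le_fix R (sem P) G Pss (@reachable R (sem P)) mx
    (@value R (sem Q) G mx)).
  - exact: reachable_edge.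
  - by move=> s _; apply: value_ge0.
  - move=> s rs; apply/(bellman_elim Gl) => //; last exact: value_at.
    by move=> nu _; apply/(bellman_elim_l mx Gl); exact: value_at.
  - exact: reach_init.
apply: (@value_le_fix R (sem Q) G Qss (@reachable R (sem P)) mx
  (@value R (sem P) G mx)).
- exact: edge_elim.
- by move=> s _; apply: value_ge0.
- move=> s rs; apply/(bellman_elim Gl) => //; last exact: value_at.
  by move=> nu _; exact: value_at.
- exact: reach_init.
Qed.

End Step.

(* Eliminating a transition trades a command with k branches into l for at most
   N commands with k - 1 such branches, N being the constant number of commands
   at l. *)
Definition elim_measure l P : nat :=
  \sum_(c <- pcmds P)
    (count (fun d => csrc d == l) (pcmds P)).+1 ^
      count (fun b => btgt b == l) (cbranches c).

Lemma elim_step_measure l P Q : self_loop_free P l -> elim_step l P Q ->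
  (elim_measure l Q < elim_measure l P)%N /\ self_loop_free Q l.
Proof.
move=> Psl [cs1 c cs2 bs1 b bs2 Pcs cbs bl ->].
have cl := elim_src_neq Pcs cbs bl Psl.
split; last exact: (elim_self_loop_free Pcs cbs bl Psl).
rewrite /elim_measure /=; set N := count _ (pcmds P).
(* New commands start at the source of [c], which differs from [l], so [N] is unchanged. *)
have new0 s : count (fun d => csrc d == l)
    [seq elim_cmd c b (bs1 ++ bs2) d | d <- s] = 0%N.
  by elim: s => //= d s ->; rewrite (negbTE cl).
rewrite !count_cat new0 addn0.
have -> : (count (fun d => csrc d == l) cs1 + count (fun d => csrc d == l) cs2 = N)%N.
  by rewrite /N Pcs count_cat /= (negbTE cl).
rewrite Pcs !big_cat big_cons /= ltn_add2l addnC ltn_add2r -Pcs big_map big_filter.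
rewrite cbs count_cat /= bl eqxx.
(* Commands at [l] do not enter [l], so every replacement keeps only the other [k - 1] branches into
   [l]; the base [N + 1] makes [N * (N + 1) ^ (k - 1)] strictly smaller than [(N + 1) ^ k]. *)
rewrite big_seq_cond (eq_bigr (fun=> N.+1 ^ count (fun b => btgt b == l) (bs1 ++ bs2))%N).
  rewrite -big_seq_cond big_const_seq iter_addn_0 -/N count_cat addnA addn1 expnS mulnC.
  by rewrite ltn_pmul2r // expn_gt0.
move=> d /andP[dP /eqP dl].
have := Psl _ dP dl; rewrite /enters has_count -eqn0Ngt count_cat count_map => d0.
by rewrite (eqP d0) addn0.
Qed.

Lemma elim_terminates l P : self_loop_free P l -> elimination_terminates l P.
Proof.
move Em: (elim_measure l P) => m.
elim/ltn_ind: m P Em => m IH P Em Psl.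
constructor=> Q PQ; have [mQ Qsl] := elim_step_measure Psl PQ.
by apply: IH Qsl; [rewrite Em in mQ; exact: mQ|].
Qed.

(** * Labelled goals and repeated elimination *)

Section Labels.
Variables (Lab : finType) (L : Loc -> Lab -> int) (theta : bexp (Var + Lab)%type).

Lemma goal_label P l nu : goal L theta (Some (l, nu) : sem_state P) =
  beval (raw_val nu) (bsubst (label_subst L l) theta).
Proof. by rewrite beval_subst; congr beval; apply/funext => -[]. Qed.

(** The loop invariant; the initial location is tracked separately. *)
Definition elim_ready P l : Prop :=
  [/\ is_pcfp P, well_formed P, self_loop_free P l, nonblocking_at P l &
      ~ potential_goal P L theta l].

Lemma elim_step_correct l P Q : elim_ready P l -> elim_step l P Q ->
  [/\ elim_ready Q l, pinit_loc Q = pinit_loc P &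
    forall mx, @value R (sem Q) (@goal _ _ _ _ Q L theta) mx (minit (sem Q)) =
               @value R (sem P) (@goal _ _ _ _ P L theta) mx (minit (sem P))].
Proof.
move=> [Pd Pwf Psl Pnb Pg] [cs1 c cs2 bs1 b bs2 Pcs cbs bl ->].
split=> // [|mx].
  split=> //.
  - exact: (elim_is_pcfp Pcs cbs).
  - exact: (elim_well_formed Pcs cbs bl Pwf).
  - exact: (elim_self_loop_free Pcs cbs bl Psl).
  - exact: (elim_nonblocking Pcs cbs bl Pwf Psl Pnb).
apply/esym/(value_elim Pcs cbs bl Pd Pwf Psl Pnb) => nu.
by rewrite goal_label; apply/negP => nug; apply: Pg; exists nu.
Qed.

Lemma elim_correct l P Q : elim_ready P l -> clos_refl_trans _ (elim_step l) P Q ->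
  [/\ elim_ready Q l, pinit_loc Q = pinit_loc P &
    forall mx, @value R (sem Q) (@goal _ _ _ _ Q L theta) mx (minit (sem Q)) =
               @value R (sem P) (@goal _ _ _ _ P L theta) mx (minit (sem P))].
Proof.
move=> rP PQ; elim: PQ rP => [P1 P2 st /elim_step_correct|P1|P1 P2 P3 _ IH1 _ IH2] //.
  exact.
by move=> /IH1 [/IH2 [r3 i3 v3] i2 v2]; split=> // [|mx]; rewrite ?i3 ?v3.
Qed.

End Labels.

(** Being away from [l] holds initially and is preserved by every edge; bottom counts as away from
    [l]. *)
Lemma unreachable_of_no_transition P l :
  l <> pinit_loc P -> ~~ has_transition_to P l -> loc_unreachable P l.
Proof.
move=> li /hasPn noP nu rs.
pose off_l (s : sem_state P) : Prop := if s is Some (l', _) then l' <> l else True.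
suff /(_ erefl) : off_l (Some (l, nu)) by [].
apply: (reachable_ind_edge (good := off_l)) rs => [|s t _]; first exact: nesym.
case/edge_sem=> l' [nu' [c [b [_ [cP _ _] bc ->]]]]; rewrite /off_l /sem_succ.
case: to_dom => //= nu1 bl; have /negP := noP c cP; apply.
by rewrite /enters; elim: (cbranches c) bc => //= x xs IH [->|/IH ->];
  rewrite ?bl ?eqxx ?orbT.
Qed.

End Semantics.

Theorem theorem1 (R : realType) (Loc Var Lab : finType)
    (P : pcfp R Loc Var) (L : Loc -> Lab -> int)
    (theta : bexp (Var + Lab)%type) (l : Loc) :
  is_pcfp P -> well_formed P ->
  l <> pinit_loc P -> ~ has_self_loop P l -> ~ potential_goal P L theta l ->
  nonblocking_at P l ->
  elimination_terminates l P /\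
  (forall P' : pcfp R Loc Var, elimination_result l P P' ->
    [/\ loc_unreachable P' l,
        max_goal_prob P L theta = max_goal_prob P' L theta
      & min_goal_prob P L theta = min_goal_prob P' L theta]).
Proof.
move=> Pd Pwf linit /self_loopP Psl Pg Pnb; split; first exact: elim_terminates.
move=> P' [PP' noP']; have rP : elim_ready L theta P l by [].
have [[P'd _ _ _ _] init' v'] := elim_correct rP PP'.
split; first by apply: unreachable_of_no_transition noP'; rewrite init'.
  by rewrite /max_goal_prob !max_reach_probE ?v' //; exact: sem_substochastic.
by rewrite /min_goal_prob !min_reach_probE ?v' //; exact: sem_substochastic.
Qed.
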